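(* Let $(\Omega,\mathfrak{A},\mu)$ be the Kolmogorovian probability for infinite sequences of coin tosses. There exist a superreal field $\mathbb{F}$ and an elementary numerosity $\mathfrak{n}:\mathcal{P}(\Omega)\to[0,+\infty)_{\mathbb{F}}$ such that the corresponding non-Archimedean probability $P:\mathcal{P}(\Omega)\to[0,1]_{\mathbb{F}}$, $P(E)=\mathfrak{n}(E)/\mathfrak{n}(\Omega)$, satisfies: (1) if $F\subset\Omega$ is finite and non-empty, then for all $E\subseteq\Omega$ the conditional probability $P(E|F)=P(E\cap F)/P(F)$ satisfies $P(E|F)=\frac{|E\cap F|}{|F|}$; (2) for every cylinder set, $P\left(C_{(t_1,\ldots,t_n)}^{(i_1,\ldots,i_n)}\right)=\mu\left(C_{(t_1,\ldots,t_n)}^{(i_1,\ldots,i_n)}\right)=2^{-n}$ (an exact equality in $\mathbb{F}$); (3) $\text{sh}(P(E))=\mu(E)$ for all $E\in\mathfrak{A}$.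
   Context: The sample space is $\Omega=\{H,T\}^{\mathbb{N}}$, the set of all functions $\omega:\mathbb{N}\to\{H,T\}$, where $\mathbb{N}$ is the set of positive integers. For indices $i_1<\ldots<i_n$ in $\mathbb{N}$ and values $t_1,\ldots,t_n\in\{H,T\}$, the cylinder set of codimension $n$ is $C_{(t_1,\ldots,t_n)}^{(i_1,\ldots,i_n)}=\{\omega\in\Omega\mid\omega(i_s)=t_s\text{ for }s=1,\ldots,n\}$. $\mathfrak{A}$ is the $\sigma$-algebra generated by the cylinder sets, and $\mu:\mathfrak{A}\to[0,1]$ is the unique ($\sigma$-additive) probability measure with $\mu\left(C_{(t_1,\ldots,t_n)}^{(i_1,\ldots,i_n)}\right)=2^{-n}$ for all cylinder sets. The triple $(\Omega,\mathfrak{A},\mu)$ is called the Kolmogorovian probability for infinite sequences of coin tosses. A superreal field is an ordered field $\mathbb{F}\supseteq\mathbb{R}$ extending the ordered field of real numbers; $[0,+\infty)_{\mathbb{F}}=\{x\in\mathbb{F}\mid x\ge 0\}$ and $[0,1]_{\mathbb{F}}=\{x\in\mathbb{F}\mid 0\le x\le 1\}$. An element $\xi\in\mathbb{F}$ is finite if $-n<\xi<n$ for some positive integer $n$; the shadow $\text{sh}(\xi)$ of a finite $\xi$ is the unique real number $r$ such that $-1/n<\xi-r<1/n$ for all positive integers $n$. An elementary numerosity on a set $\Omega$ is a function $\mathfrak{n}:\mathcal{P}(\Omega)\to[0,+\infty)_{\mathbb{F}}$, defined on all subsets of $\Omega$ with values in the non-negative part of a superreal field $\mathbb{F}$, such that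 $\mathfrak{n}(\{x\})=1$ for every $x\in\Omega$ and $\mathfrak{n}(A\cup B)=\mathfrak{n}(A)+\mathfrak{n}(B)$ whenever $A,B$ are disjoint. *)

(* Defs.v *)
From HB Require Import structures.
From mathcomp Require Import all_boot all_order all_algebra finmap.
From mathcomp Require Import all_classical all_reals all_analysis.

Set Implicit Arguments.
Unset Strict Implicit.
Unset Printing Implicit Defensive.

Import Order.TTheory GRing.Theory Num.Theory.

Local Open Scope classical_set_scope.
Local Open Scope ring_scope.

Definition posint := {k : nat | (0 < k)%N}.

(* The two faces: [true] stands for H and [false] for T. *)
Definition coin := bool.

Definition coin_seq := posint -> coin.

Definition increasing_indices n (i : 'I_n -> posint) :=
  forall s u : 'I_n, (s < u)%N -> (val (i s) < val (i u))%N.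

Definition cylinder n (i : 'I_n -> posint) (t : 'I_n -> coin) : set coin_seq :=
  [set w | forall s, w (i s) = t s].

Definition cylinders : set (set coin_seq) :=
  [set C | exists n (i : 'I_n -> posint) (t : 'I_n -> coin),
     increasing_indices i /\ C = cylinder i t].

Definition coin_space := g_sigma_algebraType cylinders.

(* The Kolmogorovian measure is the unique [mu] satisfying this predicate:
   the cylinders generate the sigma-algebra and are stable under nonempty
   intersection. *)
Definition kolmogorovian (R : realType) (mu : probability coin_space R) :=
  forall n (i : 'I_n -> posint) (t : 'I_n -> coin),
    increasing_indices i -> mu (cylinder i t) = (2 ^- n)%:E.

Record superrealField (R : realType) := SuperrealField {
  superreal_sort :> realFieldType;
  of_real : {rmorphism R -> superreal_sort};
  of_real_mono : {mono of_real : x y / x <= y} }.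

Arguments of_real {R} s.

Section Shadow.
Variables (R : realType) (F : superrealField R).
Implicit Types (xi : F) (r : R).

Definition finite_elt xi := exists2 n : nat, (0 < n)%N & - n%:R < xi < n%:R.

Definition is_shadow xi r :=
  forall n : nat, (0 < n)%N -> - n%:R^-1 < xi - of_real F r < n%:R^-1.

(* Meaningful only when [finite_elt xi]; see [shadowP] and [shadow_unique]. *)
Definition shadow xi : R := xget 0 [set r | is_shadow xi r].

Lemma of_real_lt : {mono of_real F : x y / x < y}.
Proof. exact: leW_mono (@of_real_mono R F). Qed.

Lemma is_shadow_unique xi r s : is_shadow xi r -> is_shadow xi s -> r = s.
Proof.
wlog lt_rs : r s / r < s => [H xr xs|xr xs].
  have [/H|/H sr|//] := ltgtP r s; first exact.
  by rewrite sr.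
have d0 : 0 < (s - r) / 2 by rewrite divr_gt0 ?subr_gt0.
pose n := (Num.truncn ((s - r) / 2)^-1).+1.
have nd : n%:R^-1 < (s - r) / 2.
  by rewrite invf_plt ?posrE ?ltr0n// truncnS_gt.
have /andP[_ xrn] := xr n isT; have /andP[xsn _] := xs n isT.
have : of_real F (s - r) < of_real F (2 * n%:R^-1).
  rewrite rmorphB rmorphM fmorphV !rmorph_nat mulr_natl mulr2n.
  have -> : of_real F s - of_real F r =
    (xi - of_real F r) - (xi - of_real F s) by rewrite opprB [RHS]addrC addrA addrNK.
  by rewrite ltrD// ltrNl.
rewrite of_real_lt => /(lt_trans); move/(_ (s - r)).
by rewrite -ltr_pdivlMl// mulrC nd ltxx => /(_ isT).
Qed.

Lemma is_shadow_exists xi : finite_elt xi -> exists r, is_shadow xi r.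
Proof.
move=> [n n0 /andP[nx xn]]; pose A := [set r : R | of_real F r <= xi].
have A0 : A !=set0 by exists (- n%:R); rewrite /A/= rmorphN rmorph_nat ltW.
have ubA : ubound A n%:R.
  move=> r Ar; rewrite -(@of_real_mono R F) rmorph_nat.
  exact: le_trans Ar (ltW xn).
have supA : has_sup A by split => //; exists n%:R.
exists (sup A) => k k0.
have k0' : 0 < k%:R^-1 :> R by rewrite invr_gt0 ltr0n.
apply/andP; split.
- have [r Ar] := sup_adherent k0' supA.
  rewrite -of_real_lt rmorphB fmorphV rmorph_nat => /lt_le_trans/(_ Ar).
  by rewrite ltrBrDl.
- rewrite ltNge; apply/negP; rewrite lerBrDl => kx.
  pose e : R := k%:R^-1.
  have : A (sup A + e) by rewrite /A/= rmorphD fmorphV rmorph_nat.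
  move=> /(ub_le_sup (proj2 supA)).
  by rewrite gerDl leNgt k0'.
Qed.

Lemma shadowP xi : finite_elt xi -> is_shadow xi (shadow xi).
Proof.
move=> /is_shadow_exists[r xr].
exact: (@xgetI _ 0 [set s | is_shadow xi s] r).
Qed.

Lemma shadow_unique xi r : is_shadow xi r -> shadow xi = r.
Proof.
move=> xr; apply: is_shadow_unique (xr).
exact: (@xgetI _ 0 [set s | is_shadow xi s] r).
Qed.

End Shadow.

Definition elementary_numerosity (R : realType) (F : superrealField R)
    (T : Type) (nu : set T -> F) :=
  [/\ forall A, 0 <= nu A,
      forall x, nu [set x] = 1 &
      forall A B, A `&` B = set0 -> nu (A `|` B) = nu A + nu B].

Definition numerosity_prob (R : realType) (F : superrealField R)
    (T : Type) (nu : set T -> F) (A : set T) : F := nu A / nu setT.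

Definition cond_prob (F : fieldType) (T : Type) (P : set T -> F)
    (A B : set T) : F := P (A `&` B) / P B.

(* Main.v *)
From HB Require Import structures.
Require Import Defs.
From mathcomp Require Import all_boot all_order all_algebra finmap.
From mathcomp Require Import all_classical all_reals all_analysis.
From mathcomp Require Import ring lra.

(** The numerosity of a set [E] of coin sequences is obtained by counting the
    points of [E] in finite samples [Y], and passing to an ultrapower of the
    reals indexed by these samples: [nu E] is the class of [Y |-> #(Y :&: E)],
    so that [P E] is the class of the relative frequency of [E] in [Y].
    Additivity holds sample by sample.  Everything else depends on which
    samples the ultrafilter considers as large.  By Los's principle, it is
    enough that the following requirements on [Y] hold almost everywhere:
    - [Y] contains a given point (then singletons have numerosity 1);
    - the relative frequency in [Y] of every set depending only on the first
      [N] tosses is exactly its measure (then [P] and [mu] agree on cylinders);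
    - the relative frequency of a given measurable [E] is within [1/(k+1)] of
      [mu E] (then the shadow of [P E] is [mu E]).
    Conditional probabilities on finite sets come for free, since a numerosity
    restricted to finite sets is the cardinality.

    Such an ultrafilter exists as soon as any finitely many of these
    requirements are met by a single finite sample ([fits_exists]).  Finitely
    many measurable sets, together with the first [N] tosses, cut the space
    into finitely many atoms, grouped in [2^N] blocks of measure [2^-N].  One
    takes the same large number [M] of points in each block, and distributes
    them over the atoms of the block proportionally to their measures, up to
    a rounding error that is bounded independently of [M]
    ([block_rounding]).  The prescribed points are included at a bounded cost.
    The only obstruction would be an atom which has positive measure but too
    few points; it does not occur because finite sets are null, hence atoms of
    positive measure are infinite ([fill_fibers], [sample_exists]). *)

Set Implicit Arguments.
Unset Strict Implicit.
Unset Printing Implicit Defensive.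

Import Order.TTheory GRing.Theory Num.Theory.

Local Open Scope classical_set_scope.
Local Open Scope ring_scope.
Local Open Scope quotient_scope.

(** * Ultrapowers of a real field *)

(** The ultrafilter is bundled with its proof so that the ultrapower is a type
    whose field structure can be inferred from its parameters. *)
Record ultrafilter_on (I : Type) := UltrafilterOn {
  ultrafilter_sets :> set I -> Prop;
  ultrafilter_ultra : UltraFilter ultrafilter_sets }.

#[global] Existing Instance ultrafilter_ultra.

Section NullIdeal.
Variables (K : realFieldType) (I : pointedType) (U : ultrafilter_on I).

Definition null_ideal (f : I -> K) : bool := `[< U [set i | f i = 0] >].

Lemma null_ideal_idealr_closed : idealr_closed null_ideal.
Proof.
split.
- by apply/asboolP; apply: filterE.
- apply/asboolP => U0; apply: (filter_not_empty U).
  by apply: filterS U0 => i /= /eqP; rewrite oner_eq0.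
- move=> a f g /asboolP Uf /asboolP Ug; apply/asboolP.
  apply: filterS2 Uf Ug => i /= f0 g0.
  by rewrite /GRing.add/= /GRing.mul/= f0 g0 mulr0 addr0.
Qed.

HB.instance Definition _ := isIdealr.Build (I -> K) null_ideal
  null_ideal_idealr_closed.
End NullIdeal.

Section Ultrapower.
Variables (K : realFieldType) (I : pointedType) (U : ultrafilter_on I).

Definition ultrapower :=
  Quotient.quot (Idealr.clone (I -> K) (@null_ideal K I U) _).

HB.instance Definition _ := Choice.on ultrapower.
HB.instance Definition _ := GRing.ComNzRing.on ultrapower.

Definition germ (f : I -> K) : ultrapower := \pi_ultrapower f.

Lemma germ_surj (x : ultrapower) : exists f, x = germ f.
Proof. by exists (repr x); rewrite /germ reprK. Qed.

Lemma germE (f g : I -> K) : germ f = germ g <-> U [set i | f i = g i].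
Proof.
rewrite (rwP eqP) /germ -Quotient.idealrBE.
split=> [/asboolP|Ufg]; last apply/asboolP.
  by apply: filterS => i /eqP; rewrite subr_eq0 => /eqP.
by apply: filterS Ufg => i fg; apply/eqP; rewrite subr_eq0; apply/eqP.
Qed.

Lemma germ_near (f g : I -> K) : (U [set i | f i = g i]) -> germ f = germ g.
Proof. by move=> /germE. Qed.

Lemma germD f g : germ (fun i => f i + g i) = germ f + germ g.
Proof. exact: (rmorphD (\pi_ultrapower)). Qed.
Lemma germN f : germ (fun i => - f i) = - germ f.
Proof. exact: rmorphN. Qed.
Lemma germM f g : germ (fun i => f i * g i) = germ f * germ g.
Proof. exact: rmorphM. Qed.
Lemma germ0 : germ (cst 0) = 0. Proof. exact: rmorph0. Qed.
Lemma germ1 : germ (cst 1) = 1. Proof. exact: rmorph1. Qed.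

(** This is where maximality of the filter enters: it makes every nonzero germ
    invertible and any two germs comparable. *)
Lemma ultraNP (A : set I) : ~ U A -> U (~` A).
Proof. by have [|//] := in_ultra_setVsetC A (ultrafilter_ultra U). Qed.

(* Inverting pointwise is harmless where [x] vanishes, because [0^-1 = 0]. *)
Let inv (x : ultrapower) := germ (fun i => (repr x i)^-1).

Let inv_mulV x : x != 0 -> inv x * x = 1.
Proof.
rewrite /inv -[in X in X -> _](reprK x) -[X in _ * X](reprK x) => x0.
rewrite -germM -germ1; apply: germ_near.
have /ultraNP : ~ U [set i | repr x i = 0].
  by move=> /germ_near; rewrite germ0 => /eqP; exact/negP.
by apply: filterS => i /eqP xi0; rewrite /= mulVf.
Qed.

Let inv0 : inv 0 = 0.
Proof.
rewrite -[RHS]germ0; apply: germ_near.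
have /germE : germ (repr (0 : ultrapower)) = germ (cst 0).
  by rewrite germ0 /germ reprK.
by apply: filterS => i /= ->; rewrite invr0.
Qed.

HB.instance Definition _ := GRing.ComNzRing_isField.Build ultrapower inv_mulV inv0.

Let le (x y : ultrapower) := `[< U [set i | repr x i <= repr y i] >].
Let lt (x y : ultrapower) := (y != x) && le x y.
Let norm (x : ultrapower) := germ (fun i => `|repr x i|).

Let repr_germ f : U [set i | repr (germ f) i = f i].
Proof. by apply/germE; rewrite /germ reprK. Qed.

Let leE f g : le (germ f) (germ g) <-> U [set i | f i <= g i].
Proof.
split=> [/asboolP|Ufg]; last apply/asboolP.
  by apply: filterS3 (repr_germ f) (repr_germ g) => i /= -> ->.
by apply: filterS3 Ufg (repr_germ f) (repr_germ g) => i /= + -> ->.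
Qed.

Let normE f : norm (germ f) = germ (fun i => `|f i|).
Proof. by apply: germ_near; apply: filterS (repr_germ f) => i /= ->. Qed.

Let le0_add x y : le 0 x -> le 0 y -> le 0 (x + y).
Proof.
have [f ->] := germ_surj x; have [g ->] := germ_surj y.
rewrite -germ0 -germD => /leE Uf /leE Ug; apply/leE.
by apply: filterS2 Uf Ug => i; exact: addr_ge0.
Qed.

Let le0_mul x y : le 0 x -> le 0 y -> le 0 (x * y).
Proof.
have [f ->] := germ_surj x; have [g ->] := germ_surj y.
rewrite -germ0 -germM => /leE Uf /leE Ug; apply/leE.
by apply: filterS2 Uf Ug => i; exact: mulr_ge0.
Qed.

Let le0_anti x : le 0 x -> le x 0 -> x = 0.
Proof.
have [f ->] := germ_surj x; rewrite -germ0 => /leE Uf /leE Uf'.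
apply: germ_near; apply: filterS2 Uf Uf' => i f0 f0'.
by apply/eqP; rewrite eq_le f0 f0'.
Qed.

Let sub_ge0 x y : le 0 (y - x) = le x y.
Proof.
have [f ->] := germ_surj x; have [g ->] := germ_surj y.
rewrite -germ0 -germN -germD; apply/idP/idP => /leE Uf; apply/leE;
  by apply: filterS Uf => i /=; rewrite subr_ge0.
Qed.

Let le0_total x : le 0 x || le x 0.
Proof.
have [f ->] := germ_surj x; rewrite -germ0.
have [|/ultraNP] := pselect (U [set i | 0 <= f i]); first by move/leE => ->.
move=> Uf; apply/orP; right; apply/leE; apply: filterS Uf => i /=.
by move/negP; rewrite -ltNge => /ltW.
Qed.

Let normN x : norm (- x) = norm x.
Proof.
have [f ->] := germ_surj x; rewrite -germN !normE.
by congr germ; apply/funext => i; rewrite normrN.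
Qed.

Let ge0_norm x : le 0 x -> norm x = x.
Proof.
have [f ->] := germ_surj x; rewrite -germ0 normE => /leE Uf.
by apply: germ_near; apply: filterS Uf => i; exact: ger0_norm.
Qed.

HB.instance Definition _ := Num.IntegralDomain_isLeReal.Build ultrapower
  le0_add le0_mul le0_anti sub_ge0 le0_total normN ge0_norm (fun _ _ => erefl).

Lemma germ_le f g : germ f <= germ g <-> U [set i | f i <= g i].
Proof. exact: leE. Qed.

Lemma germV f : germ (fun i => (f i)^-1) = (germ f)^-1.
Proof.
have [f0|f0] := eqVneq (germ f) 0.
  rewrite f0 invr0 -germ0; apply: germ_near.
  by move: f0; rewrite -germ0 => /germE; apply: filterS => i /= ->; rewrite invr0.
apply: (mulIf f0); rewrite mulVf// -germM -germ1; apply: germ_near.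
have /ultraNP : ~ U [set i | f i = 0].
  by move=> /germ_near; rewrite germ0 => /eqP; exact/negP.
by apply: filterS => i /eqP fi0; rewrite /= mulVf.
Qed.

End Ultrapower.


Section Superreal.
Variables (R : realType) (I : pointedType) (U : ultrafilter_on I).

Definition constant_germ (r : R) : ultrapower R U := germ U (cst r).

Fact constant_germ_zmod : zmod_morphism constant_germ.
Proof. by move=> r s; rewrite /constant_germ -germN -germD. Qed.

Fact constant_germ_monoid : monoid_morphism constant_germ.
Proof.
by split=> [|r s]; [exact: germ1 | rewrite /constant_germ -germM].
Qed.

HB.instance Definition _ :=
  GRing.isZmodMorphism.Build R (ultrapower R U) constant_germ constant_germ_zmod.
HB.instance Definition _ :=
  GRing.isMonoidMorphism.Build R (ultrapower R U) constant_germ constant_germ_monoid.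

Lemma constant_germ_le : {mono constant_germ : r s / r <= s}.
Proof.
move=> r s; apply/idP/idP => [/germ_le Urs|rs].
  by have [] := filter_ex Urs.
by apply/germ_le; apply: filterE => i.
Qed.

Definition ultrapower_superreal : superrealField R :=
  SuperrealField constant_germ_le.
End Superreal.

(** * Counting the points of a finite sample *)

Section Hits.
Variable T : choiceType.
Implicit Types (X Y : {fset T}) (A B : set T).

Definition hits X A : nat := (\sum_(x <- X) (x \in A))%N.

Lemma hits_fsetU1 y X A : y \notin X ->
  hits (y |` X)%fset A = ((y \in A) + hits X A)%N.
Proof. by move=> yX; rewrite /hits big_fsetU1. Qed.

Lemma hitsT X : hits X setT = #|` X|.
Proof.
rewrite /hits cardfE -sum1_card big_seq_fsetE/=.
by apply: eq_bigr => x _; rewrite in_setT.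
Qed.

Lemma hitsU X A B : A `&` B = set0 -> hits X (A `|` B) = (hits X A + hits X B)%N.
Proof.
move=> AB0; rewrite /hits -big_split/=; apply: eq_bigr => x _.
rewrite in_setU; have [xA|]//= := boolP (x \in A).
suff /negbTE -> : x \notin B by [].
apply/negP => xB; have : x \in A `&` B by rewrite in_setI xA.
by rewrite AB0 in_set0.
Qed.

Lemma hits1 X x : x \in X -> hits X [set x] = 1%N.
Proof.
move=> xX; rewrite /hits (big_fsetD1 x)//= in_set1 eqxx big_seq big1 ?addn0// => y.
by rewrite !inE => /andP[/negbTE yx _]; rewrite in_set1 yx.
Qed.

Lemma hits_preimage (J : finType) (a : T -> J) X (S : set J) :
  hits X (a @^-1` S) = (\sum_(j | j \in S) hits X (a @^-1` [set j]))%N.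
Proof.
rewrite /hits exchange_big/=; apply: eq_bigr => x _.
have E j : (x \in a @^-1` [set j]) = (j == a x).
  by apply/idP/eqP; rewrite inE/= => ->.
under eq_bigr do rewrite E.
have -> : (x \in a @^-1` S) = (a x \in S) by apply/idP/idP; rewrite !inE.
have [aS|aS] := boolP (a x \in S).
  rewrite (bigD1 (a x))//= eqxx big1 ?addn0// => j.
  by move=> /andP[_ /negbTE ->].
rewrite big1// => j jS; case: eqP => // jx; by rewrite -jx jS in aS.
Qed.

(** Points are added to [X] one by one, each time in a fiber that still lacks
    some; such a fiber is infinite, so it has a point outside the current
    sample.  The induction is on the total number of missing points. *)
Lemma fill_fibers (J : finType) (a : T -> J) X (c : J -> nat) :
  (forall j, (hits X (a @^-1` [set j]) <= c j)%N) ->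
  (forall j, (hits X (a @^-1` [set j]) < c j)%N ->
     infinite_set (a @^-1` [set j])) ->
  exists2 Y, {subset X <= Y} & forall j, hits Y (a @^-1` [set j]) = c j.
Proof.
move Hm : (\sum_j (c j - hits X (a @^-1` [set j])))%N => m.
elim: m X Hm => [|m IH] X Hm lec inf.
  exists X => // j; apply/eqP; rewrite eqn_leq lec/= -subn_eq0.
  by move/eqP: Hm; rewrite sum_nat_eq0 => /forallP /(_ j).
have [j ltj] : exists j, (hits X (a @^-1` [set j]) < c j)%N.
  apply/existsP; move/eqP: Hm; apply: contraTT; rewrite negb_exists => /forallP H.
  by rewrite big1// => j _; apply/eqP; rewrite subn_eq0 leqNgt.
have [y [ayj yX]] : exists y, a y = j /\ y \notin X.
  apply: contrapT => H; apply: (inf j ltj).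
  apply: (@sub_finite_set _ _ [set` X]); last exact: finite_fset.
  by move=> y /= ayj; apply/negPn/negP => yX; apply: H; exists y.
have hY i : hits (y |` X)%fset (a @^-1` [set i])
    = ((i == j) + hits X (a @^-1` [set i]))%N.
  rewrite hits_fsetU1//; congr (nat_of_bool _ + _)%N.
  by apply/idP/eqP; rewrite inE/= ayj.
have [||i|Y XY HY] := IH (y |` X)%fset.
- move: Hm; rewrite (bigD1 j)//= [X in _ -> X = _](bigD1 j)//= hY eqxx add1n subnS.
  under [X in _ -> (_ + X)%N = _]eq_bigr => i /negbTE ij do rewrite hY ij add0n.
  by move: ltj; rewrite -subn_gt0; case: (c j - _)%N => // k _ /=; rewrite addSn => -[].
- by move=> i; rewrite hY; case: eqP => [->//|_]; rewrite add0n.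
- by rewrite hY => ?; apply: inf; apply: leq_ltn_trans (leq_addl _ _) _; eassumption.
- by exists Y => // x xX; apply: XY; rewrite !inE xX orbT.
Qed.

End Hits.

(** * Rounding weights to integers *)

Section Rounding.
Variable R : realType.

(** The [M] units are distributed as [x j] plus the integral part of [M * q j],
    except that one index [j0] of positive weight receives all that is left.
    For large [M] this leaves at least [x j0] units for [j0], because
    [M * q j0] is then larger than the sum of the [x j].  The errors are at
    most [x j + 1] off [j0] and the sum of these bounds at [j0], hence a
    constant [K] that does not depend on [M]. *)
Lemma rounding (J : finType) (q : J -> R) (x : J -> nat) :
  (forall j, 0 <= q j) -> \sum_j q j = 1 ->
  exists K : R, exists M0 : nat, forall M, (M0 <= M)%N ->
    exists c : J -> nat,
    [/\ forall j, (x j <= c j)%N, forall j, q j = 0 -> c j = x j,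
        (\sum_j c j)%N = M & forall j, `|(c j)%:R - M%:R * q j| <= K].
Proof.
move=> q0 q1.
have [j0 qj0] : exists j, 0 < q j.
  apply: contrapT => H; have := oner_neq0 R; rewrite -q1 big1 ?eqxx// => j _.
  apply/eqP; rewrite eq_le q0 andbT leNgt; apply/negP => qj; apply: H.
  by exists j.
pose xs : R := \sum_j (x j)%:R.
pose K : R := \sum_j ((x j)%:R + 1).
have xsK j : (x j)%:R + 1 <= K.
  by rewrite /K (bigD1 j)//= lerDl sumr_ge0.
exists K, (Num.truncn (xs / q j0)).+1 => M leM.
pose f j := Num.truncn (M%:R * q j).
have Mq0 j : 0 <= M%:R * q j by rewrite mulr_ge0.
have f_le j : (f j)%:R <= M%:R * q j by rewrite truncn_le.
have f_gt j : M%:R * q j < (f j)%:R + 1 by rewrite natr1 truncnS_gt.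
pose c' j := (x j + f j)%N.
pose rest := (\sum_(j | j != j0) c' j)%N.
have Msum : M%:R = M%:R * q j0 + \sum_(j | j != j0) M%:R * q j.
  by rewrite -[LHS]mulr1 -q1 (bigD1 j0)//= mulrDr mulr_sumr.
have restE : rest%:R = \sum_(j | j != j0) (x j)%:R + \sum_(j | j != j0) (f j)%:R :> R.
  by rewrite natr_sum -big_split/=; apply: eq_bigr => j _; rewrite natrD.
have xsE : xs = (x j0)%:R + \sum_(j | j != j0) (x j)%:R by rewrite /xs (bigD1 j0).
have f_sum : \sum_(j | j != j0) (f j)%:R <= \sum_(j | j != j0) M%:R * q j :> R.
  exact: ler_sum.
have xsM : xs <= M%:R * q j0.
  rewrite -ler_pdivrMr//; apply: ltW; apply: lt_le_trans (truncnS_gt _) _.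
  by rewrite ler_nat.
have le_rest : (x j0 + rest <= M)%N.
  rewrite -(ler_nat R) natrD restE; lra.
have le_rest' : (rest <= M)%N by apply: leq_trans le_rest; exact: leq_addl.
exists (fun j => if j == j0 then (M - rest)%N else c' j); split.
- move=> j; case: eqP => [->|_]; last exact: leq_addr.
  by rewrite leq_subRL// addnC.
- move=> j qj; case: eqP => [jj0|_]; first by rewrite -jj0 qj ltxx in qj0.
  by rewrite /c' /f qj mulr0 truncn0 addn0.
- rewrite (bigD1 j0)//= eqxx; under eq_bigr => j /negbTE -> do [].
  by rewrite subnK.
- move=> j; case: eqP => [->|_].
    rewrite natrB// restE; have := Msum.
    have : \sum_(j | j != j0) M%:R * q j <= \sum_(j | j != j0) ((f j)%:R + 1).
      by apply: ler_sum => i _; exact: ltW.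
    rewrite big_split/=.
    have : K = (x j0)%:R + 1 + (\sum_(j | j != j0) (x j)%:R + \sum_(j | j != j0) 1).
      by rewrite /K (bigD1 j0)//= big_split.
    have : 0 <= (x j0)%:R :> R by [].
    have : 0 <= \sum_(j | j != j0) (x j)%:R :> R by rewrite sumr_ge0.
    have : 0 <= \sum_(j | j != j0) 1 :> R by rewrite sumr_ge0.
    rewrite ler_norml => *; apply/andP; split; lra.
  apply: le_trans (xsK j); rewrite ler_norml /c' natrD.
  have := f_le j; have := f_gt j; have : 0 <= (x j)%:R :> R by [].
  by move=> *; apply/andP; split; lra.
Qed.

(** The blocks are the fibers of [be], all of weight [1/#|B|].  Rounding is
    applied in each block to the conditional weights [#|B| * p j], with the
    same total [M] for all blocks; the bound on the rounding error does not
    grow with [M], so it becomes negligible after division by [M]. *)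
Lemma block_rounding (J B : finType) (be : J -> B) (p : J -> R) (x : J -> nat)
    (e : R) : 0 < e -> (forall j, 0 <= p j) ->
  (forall b, \sum_(j | be j == b) p j = #|B|%:R^-1) ->
  exists2 M, (0 < M)%N & exists c : J -> nat,
    [/\ forall j, (x j <= c j)%N, forall j, p j = 0 -> c j = x j,
        forall b, (\sum_(j | be j == b) c j)%N = M &
        forall j, `|(c j)%:R / (M * #|B|)%:R - p j| <= e].
Proof.
move=> e0 p0 pB.
have B0 (b : B) : #|B|%:R != 0 :> R.
  by rewrite pnatr_eq0 -lt0n; apply/card_gt0P; exists b.
have /choice[K /choice[M0 HK]] : forall b : B,
    exists K : R, exists M0 : nat, forall M, (M0 <= M)%N ->
    exists c : J -> nat,
    [/\ forall j, be j = b -> (x j <= c j)%N,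
        forall j, (be j = b -> p j = 0) -> c j = (if be j == b then x j else 0),
        (\sum_j c j)%N = M &
        forall j, be j = b -> `|(c j)%:R - M%:R * (#|B|%:R * p j)| <= K].
  move=> b.
  have [|//|K [M0 H]] := @rounding J
    (fun j => if be j == b then #|B|%:R * p j else 0)
    (fun j => if be j == b then x j else 0%N).
  - by move=> j; case: ifP => // _; rewrite mulr_ge0.
  - by rewrite -big_mkcond/= -mulr_sumr pB mulfV ?(B0 b).
  exists K, M0 => M /H[c [c1 c2 c3 c4]]; exists c; split => //.
  - by move=> j jb; have := c1 j; rewrite jb eqxx.
  - by move=> j jb; apply: c2; case: eqP => // /jb ->; rewrite mulr0.
  - by move=> j jb; have := c4 j; rewrite jb eqxx.
(* A sum is used as an upper bound valid for all blocks at once; the second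
   term makes the error [K b] smaller than [e * M]. *)
pose M := (\sum_b (M0 b + Num.truncn (K b / e)) + 1)%N.
have leM b : (M0 b + Num.truncn (K b / e) < M)%N.
  by rewrite /M (bigD1 b)//= addn1 ltnS leq_addr.
have /choice[c Hc] b := HK b M (ltnW (leq_ltn_trans (leq_addr _ _) (leM b))).
exists M; first by rewrite /M addn1.
exists (fun j => c (be j) j); split.
- by move=> j; have [H _ _ _] := Hc (be j); exact: H.
- by move=> j pj; have [_ H _ _] := Hc (be j); rewrite H// eqxx.
- move=> b; have [_ H <- _] := Hc b; rewrite big_mkcond/=; apply: eq_bigr => j _.
  by case: eqP => [->//|jb]; rewrite H//; case: eqP.
- move=> j; have [_ _ _ /(_ _ erefl) H] := Hc (be j).
  have M0' : 0 < M%:R :> R by rewrite ltr0n /M addn1.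
  have b0 : 0 < #|B|%:R :> R by rewrite lt0r (B0 (be j)) ler0n.
  have -> : (c (be j) j)%:R / (M * #|B|)%:R - p j =
     ((c (be j) j)%:R - M%:R * (#|B|%:R * p j)) / (M * #|B|)%:R.
    rewrite natrM; field; by rewrite !gt_eqF.
  rewrite normrM normfV (ger0_norm (ler0n R (M * #|B|))) ler_pdivrMr ?natrM ?mulr_gt0//.
  apply: le_trans H _; rewrite mulrA; apply: (@le_trans _ _ (e * M%:R)).
    rewrite -ler_pdivrMl// mulrC; apply: ltW; apply: lt_le_trans (truncnS_gt _) _.
    by rewrite ler_nat; apply: leq_ltn_trans (leM (be j)); exact: leq_addl.
  by apply: ler_peMr; rewrite ?ler1n -?(ltr0n R)// mulr_ge0// ltW.
Qed.

End Rounding.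

(** * Finite samples with prescribed frequencies *)

Section Sampling.
Context d (T : measurableType d) (R : realType) (mu : probability T R).

Lemma measurable_preimage_fintype (J : finType) (a : T -> J) (S : set J) :
  (forall j, measurable (a @^-1` [set j])) -> measurable (a @^-1` S).
Proof.
move=> ma; have -> : a @^-1` S = \bigcup_(j in S) a @^-1` [set j].
  by apply/seteqP; split=> [x aS|x [j Sj /= ->]//]; exists (a x).
exact: fin_bigcup_measurable.
Qed.

Lemma fine_measure_preimage (J : finType) (a : T -> J) (S : set J) :
  (forall j, measurable (a @^-1` [set j])) ->
  fine (mu (a @^-1` S)) = \sum_(j | j \in S) fine (mu (a @^-1` [set j])).
Proof.
move=> ma; have -> : a @^-1` S = \bigcup_(j in S) a @^-1` [set j].
  by apply/seteqP; split=> [x aS|x [j Sj /= ->]//]; exists (a x).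
rewrite measure_fin_bigcup//; [|exact: finite_finset|by move=> i j _ _ [x [/= <- <-]]].
have SE : S = [set` enum (mem S)].
  by apply/seteqP; split => j /=; rewrite mem_enum inE.
rewrite (eq_fsbigl _ _ _ SE).
rewrite -fsbig_seq ?enum_uniq// big_enum/= -sum_fine// => j _.
exact: fin_num_measure.
Qed.

Hypothesis finite_null : forall A, finite_set A -> measurable A -> mu A = 0%E.

(** [a] maps a point to its atom and [be] an atom to its block.  Frequencies are
    exact on unions of blocks because all blocks receive equally many points;
    they are only approximate on unions of atoms, whose measures may be
    irrational. *)
Lemma sample_exists (J B : finType) (a : T -> J) (be : J -> B) (X : {fset T})
    (e : R) : 0 < e -> (forall j, measurable (a @^-1` [set j])) ->
  (forall b, fine (mu (a @^-1` (be @^-1` [set b]))) = #|B|%:R^-1) ->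
  exists Y : {fset T}, [/\ {subset X <= Y},
    forall S : set B, (hits Y (a @^-1` (be @^-1` S)))%:R / #|` Y|%:R =
      fine (mu (a @^-1` (be @^-1` S))) &
    forall S : set J, `|(hits Y (a @^-1` S))%:R / #|` Y|%:R -
      fine (mu (a @^-1` S))| <= e].
Proof.
move=> e0 ma mB.
pose p j := fine (mu (a @^-1` [set j])).
have p0 j : 0 <= p j by exact: fine_ge0.
have pB b : \sum_(j | be j == b) p j = #|B|%:R^-1.
  rewrite -(mB b) fine_measure_preimage//; apply: eq_bigl => j.
  by apply/eqP/idP; rewrite inE.
(* A union of atoms adds up at most [#|J|] errors. *)
pose e' : R := e / #|J|.+1%:R.
have e'0 : 0 < e' by rewrite divr_gt0.
have [M M0 [c [c1 c2 c3 c4]]] :=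
  block_rounding (fun j => hits X (a @^-1` [set j])) e'0 p0 pB.
have [j|Y XY HY] := fill_fibers c1.
  (* A fiber that must grow has positive measure, so it cannot be finite. *)
  move=> lt_c finj; move: lt_c; rewrite c2 ?ltnn// /p.
  by rewrite (finite_null finj).
have HS S : hits Y (a @^-1` S) = (\sum_(j | j \in S) c j)%N.
  by rewrite hits_preimage; under eq_bigr do rewrite HY.
have HB b : hits Y (a @^-1` (be @^-1` [set b])) = M.
  rewrite HS -(c3 b); apply: eq_bigl => j.
  by apply/idP/eqP; rewrite inE.
have cardY : #|` Y| = (M * #|B|)%N.
  rewrite -hitsT (_ : setT = (be \o a) @^-1` setT)// hits_preimage.
  rewrite mulnC -sum_nat_const big_mkcond/=; apply: eq_bigr => b _.
  by rewrite in_setT -(HB b).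
have M0' : M%:R != 0 :> R by rewrite pnatr_eq0 -lt0n.
exists Y; split => //.
- move=> S; rewrite -[_ @^-1` _]/((be \o a) @^-1` S) hits_preimage.
  rewrite fine_measure_preimage; last first.
    by move=> b; exact: (@measurable_preimage_fintype _ a (be @^-1` [set b])).
  rewrite natr_sum mulr_suml; apply: eq_bigr => b _.
  by rewrite (HB b) (mB b) cardY natrM invfM mulrA mulfV ?mul1r.
- move=> S; rewrite fine_measure_preimage// HS natr_sum mulr_suml -sumrB.
  apply: le_trans (ler_norm_sum _ _ _) _.
  apply: (@le_trans _ _ (\sum_(j : J) e')).
    rewrite [leRHS](bigID (fun j => j \in S))/= ler_wpDr ?sumr_ge0//.
    by move=> j _; exact: ltW.
    by apply: ler_sum => j _; rewrite cardY.
  rewrite sumr_const -mulr_natl /e' mulrCA ler_piMr ?ltW//.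
  by rewrite ltr_pdivrMr// mul1r ltr_nat.
Qed.

End Sampling.

(** * Elementary numerosities *)

Section Numerosity.
Variables (R : realType) (F : superrealField R) (T : choiceType).
Variable (nu : set T -> F).
Hypothesis nuP : elementary_numerosity nu.

Lemma numerosity_fset (X : {fset T}) : nu [set` X] = #|` X|%:R.
Proof.
have [nu0 nu1 nuU] := nuP.
have nuset0 : nu set0 = 0.
  have := nuU set0 set0; rewrite setI0 setU0 => /(_ erefl) /eqP.
  by rewrite -subr_eq0 opprD addNKr oppr_eq0 => /eqP.
elim: {X}(#|` X|) {-2}X (erefl #|` X|) => [|n IH] X.
  by move=> /cardfs0_eq ->; rewrite set_fset0 nuset0.
move=> cX; have [x xX] : exists x, x \in X by apply/fset0Pn; rewrite -cardfs_gt0 cX.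
rewrite -(fsetD1K xX) set_fsetU set_fset1 nuU; last first.
  by apply/seteqP; split=> // y /= [->]; rewrite !inE eqxx.
have cXx : #|` (X `\ x)%fset| = n by move: cX; rewrite (cardfsD1 x) xX => -[].
by rewrite nu1 IH// cXx fsetD1K// cX -natr1 addrC.
Qed.

Lemma numerosity_finite A : finite_set A -> nu A = #|` fset_set A|%:R.
Proof. by move=> fA; rewrite -numerosity_fset fset_setK. Qed.

Lemma numerosity_le A B : A `<=` B -> nu A <= nu B.
Proof.
have [nu0 _ nuU] := nuP; move=> AB.
by rewrite -(setDUK AB) nuU ?lerDl// setDIK.
Qed.

Lemma numerosityT_gt0 (x : T) : 0 < nu setT.
Proof.
have [_ nu1 _] := nuP.
by apply: lt_le_trans (ltr01) _; rewrite -(nu1 x); exact: numerosity_le.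
Qed.

Lemma numerosity_prob_ge0_le1 (x : T) A : 0 <= numerosity_prob nu A <= 1.
Proof.
have [nu0 _ _] := nuP; rewrite /numerosity_prob divr_ge0//=.
by rewrite ler_pdivrMr ?mul1r ?numerosity_le// (numerosityT_gt0 x).
Qed.

Lemma numerosity_cond_prob A B : finite_set B -> B !=set0 ->
  cond_prob (numerosity_prob nu) A B =
    #|` fset_set (A `&` B)|%:R / #|` fset_set B|%:R.
Proof.
move=> fB [x _]; rewrite /cond_prob /numerosity_prob.
rewrite invf_div mulrA mulfVK ?gt_eqF ?(numerosityT_gt0 x)//.
rewrite !numerosity_finite//; exact: finite_setIr.
Qed.
End Numerosity.

(** * Samples of coin sequences *)

Section Coins.
Variables (R : realType) (mu : probability coin_space R).
Hypothesis muK : kolmogorovian mu.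

(** Tosses are numbered from 1, the elements of ['I_N] from 0. *)
Definition nth_posint (i : nat) : posint := exist _ i.+1 isT.

Definition prefix N (w : coin_seq) : {ffun 'I_N -> bool} :=
  [ffun i : 'I_N => w (nth_posint i)].

Lemma prefix_preimage1 N b :
  @prefix N @^-1` [set b] = cylinder (fun i : 'I_N => nth_posint i) b.
Proof.
apply/seteqP; split => [w /= <- i|w wb]; first by rewrite ffunE.
by apply/ffunP => i; rewrite ffunE.
Qed.

Lemma measurable_cylinder n (i : 'I_n -> posint) t : increasing_indices i ->
  measurable (cylinder i t : set coin_space).
Proof. by move=> ii; apply: sub_sigma_algebra; exists n, i, t. Qed.

Lemma measurable_prefix N b : measurable (@prefix N @^-1` [set b] : set coin_space).
Proof. by rewrite prefix_preimage1; apply: measurable_cylinder. Qed.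

Lemma measure_prefix N b : fine (mu (@prefix N @^-1` [set b])) = 2 ^- N.
Proof. by rewrite prefix_preimage1 muK. Qed.

Lemma singleton_bigcap (w : coin_seq) :
  [set w] = \bigcap_N (@prefix N @^-1` [set prefix N w]).
Proof.
apply/seteqP; split => [_ -> N _//|v vw]; apply/funext => -[[//|k] k0].
have /ffunP/(_ ord_max) := vw k.+1 I; rewrite !ffunE.
by rewrite (_ : nth_posint _ = exist _ k.+1 k0)//; exact: val_inj.
Qed.

Lemma measurable_singleton w : measurable ([set w] : set coin_space).
Proof.
by rewrite singleton_bigcap; apply: bigcapT_measurable => N; exact: measurable_prefix.
Qed.

(** A point lies in a cylinder of measure [2^-N] for every [N]. *)
Lemma singleton_null w : mu [set w] = 0%E.
Proof.
apply/eqP; rewrite eq_le measure_ge0 andbT; apply/lee_addgt0Pr => e e0.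
rewrite add0e.
pose N := Num.truncn e^-1.
apply: (@le_trans _ _ (mu (@prefix N @^-1` [set prefix N w]))).
  apply: le_measure; rewrite ?inE.
  - exact: measurable_singleton.
  - exact: measurable_prefix.
  - by move=> _ ->.
rewrite prefix_preimage1 muK// lee_fin.
rewrite invf_ple ?posrE ?exprn_gt0//.
apply: ltW; apply: lt_le_trans (truncnS_gt _) _.
by rewrite -natrX ler_nat ltn_expl.
Qed.

Lemma finite_null (A : set coin_space) : finite_set A -> measurable A -> mu A = 0%E.
Proof.
move=> fA _; have AE : A = \bigcup_(w in A) [set w] by rewrite bigcup_imset1 image_id.
rewrite AE measure_fin_bigcup//.
- by apply: fsbig1 => w _; exact: singleton_null.
- by move=> v w _ _ [_ [-> ->]].
- by move=> w _; exact: measurable_singleton.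
Qed.

(** These sets are the unions of blocks, on which a single sample can be exact.
    They are preferred to the cylinders with indices at most [N] because their
    frequencies and measures then agree without counting, for a given cylinder,
    the blocks that it contains. *)
Definition prefix_determined N (C : set coin_seq) :=
  forall v w, prefix N v = prefix N w -> C v -> C w.

Lemma prefix_determinedE N C : prefix_determined N C ->
  C = @prefix N @^-1` (@prefix N @` C).
Proof.
move=> NC; apply/seteqP; split=> [w Cw|w [v Cv vw]]; first by exists w.
exact: NC Cv.
Qed.

Lemma prefix_determined_le N N' C : (N <= N')%N ->
  prefix_determined N C -> prefix_determined N' C.
Proof.
move=> NN' NC v w vw; apply: NC; apply/ffunP => i.
by move/ffunP: vw => /(_ (widen_ord NN' i)); rewrite !ffunE.
Qed.

Lemma cylinder_prefix_determined n (i : 'I_n -> posint) t :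
  exists N, prefix_determined N (cylinder i t).
Proof.
exists (\max_s val (i s))%N => v w vw Cv s; rewrite -Cv.
have i0 := valP (i s); have lti : ((val (i s)).-1 < \max_s val (i s))%N.
  by rewrite prednK//; exact: (leq_bigmax s).
move/ffunP: vw => /(_ (Ordinal lti)); rewrite !ffunE.
rewrite (_ : nth_posint _ = i s)//; apply: val_inj => /=.
by rewrite prednK.
Qed.

Definition fits (N : nat) (Es : seq (set coin_space)) (k : nat) (Y : {fset coin_seq}) :=
  (forall C, prefix_determined N C ->
     (hits Y C)%:R / #|` Y|%:R = fine (mu C)) /\
  (forall E, E \in Es ->
     `|(hits Y E)%:R / #|` Y|%:R - fine (mu E)| <= k.+1%:R^-1).

(** The atom of a sequence records its first [N] tosses and the members of [Es]
    it belongs to; the first component alone gives the block. *)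
Lemma fits_exists (X : {fset coin_seq}) N Es k : (forall E, E \in Es -> measurable E) ->
  exists2 Y : {fset coin_seq}, {subset X <= Y} & fits N Es k Y.
Proof.
move=> mE.
pose J : finType := ({ffun 'I_N -> bool} * {ffun 'I_(size Es) -> bool})%type.
pose a (w : coin_space) : J := (prefix N w, [ffun i => w \in nth set0 Es (val i)]).
have [//|j|b|Y [XY YC YE]] :=
  @sample_exists _ _ _ mu finite_null J _ a fst X k.+1%:R^-1.
- have -> : a @^-1` [set j] = (@prefix N @^-1` [set j.1]) `&`
    \bigcap_(i in [set: 'I_(size Es)])
      (if j.2 i then nth set0 Es i else ~` nth set0 Es i).
    case: j => b h; apply/seteqP; split => [w [<- <-]|w [/= wb wh]].
      split => // i _ /=; rewrite ffunE; case: ifP; first by rewrite inE.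
      by move=> /negbT; rewrite notin_setE.
    congr (_, _) => //; apply/ffunP => i; rewrite ffunE.
    have := wh i I; case: (h i) => /=; [exact: mem_set|exact: memNset].
  apply: measurableI; first exact: measurable_prefix.
  apply: fin_bigcap_measurable; first exact: finite_finset.
  move=> i _; have mi : measurable (nth set0 Es i).
    by apply: mE; apply: mem_nth; exact: ltn_ord.
  by case: ifP => // _; exact: measurableC.
- rewrite [_ @^-1` _](_ : _ = @prefix N @^-1` [set b])// measure_prefix.
  by rewrite card_ffun card_bool card_ord natrX.
exists Y => //; split => [C /prefix_determinedE ->|E EEs].
  exact: (YC (@prefix N @` C)).
have iE : (index E Es < size Es)%N by rewrite index_mem.
have -> : E = a @^-1` [set j : J | j.2 (Ordinal iE)].
  by apply/seteqP; split => w; rewrite /= ffunE/= nth_index// inE.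
exact: YE.
Qed.

(** The samples subject to finitely many requirements form a filter base:
    requirements [X, N, Es, k] and [X', N', Es', k'] both follow from the
    requirements [X :|: X', max N N', Es ++ Es', max k k']. *)
Lemma fits_ultrafilter : exists U : ultrafilter_on {fset coin_seq},
  (forall w : coin_seq, U [set Y : {fset coin_seq} | w \in Y]) /\
  (forall N Es k, (forall E, E \in Es -> measurable E) -> U (fits N Es k)).
Proof.
pose D := [set p : {fset coin_seq} * nat * seq (set coin_space) * nat |
  forall E, E \in p.1.2 -> measurable E].
pose G (p : {fset coin_seq} * nat * seq (set coin_space) * nat) : set {fset coin_seq} :=
  [set Y : {fset coin_seq} |
    {subset p.1.1.1 <= Y} /\ fits p.1.1.2 p.1.2 p.2 Y].
have GF : ProperFilter (filter_from D G).
  apply: filter_from_proper; last first.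
    move=> [[[X N] Es] k] mE.
    by have [Y XY fY] := @fits_exists X N Es k mE; exists Y.
  apply: filter_from_filter; first by exists (fset0, 0%N, [::], 0%N).
  move=> [[[X N] Es] k] [[[X' N'] Es'] k'] mE mE'.
  exists ((X `|` X')%fset, maxn N N', Es ++ Es', maxn k k').
    by move=> E /=; rewrite mem_cat => /orP[/mE|/mE'].
  move=> Y [/= XY [YC YE]].
  have le_max k1 k2 E x : (k1 <= k2)%N -> `|x - fine (mu E)| <= k2.+1%:R^-1 ->
      `|x - fine (mu E)| <= k1.+1%:R^-1.
    by move=> k12 /le_trans -> //; rewrite lef_pV2 ?posrE// ler_nat.
  split; split => //=.
  - by move=> x xX; apply: XY; rewrite inE xX.
  - split=> [C NC|E EE].
      by apply: YC; apply: prefix_determined_le NC; exact: leq_maxl.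
    by apply: le_max (YE E _); rewrite ?leq_maxl// mem_cat EE.
  - by move=> x xX; apply: XY; rewrite inE xX orbT.
  - split=> [C NC|E EE].
      by apply: YC; apply: prefix_determined_le NC; exact: leq_maxr.
    by apply: le_max (YE E _); rewrite ?leq_maxr// mem_cat EE orbT.
have [U [UU GU]] := ultraFilterLemma GF.
exists (UltrafilterOn UU); split => [w|N Es k mE]; apply: GU.
- exists ([fset w]%fset, 0%N, [::], 0%N) => // Y [/= wY _].
  by apply: wY; rewrite inE.
- by exists (fset0, N, Es, k) => // Y [].
Qed.

End Coins.

Theorem corollary4p3 (R : realType) (mu : probability coin_space R)
    (mu_kolmogorovian : kolmogorovian mu) :
  exists (F : superrealField R) (nu : set coin_seq -> F),
    elementary_numerosity nu /\
    let P := numerosity_prob nu in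
    [/\ forall E : set coin_seq, 0 <= P E <= 1,
        forall B : set coin_seq, finite_set B -> B !=set0 ->
          forall E : set coin_seq,
            cond_prob P E B = #|` fset_set (E `&` B)|%:R / #|` fset_set B|%:R,
        forall (n : nat) (i : 'I_n -> posint) (t : 'I_n -> coin),
          increasing_indices i ->
          P (cylinder i t) = of_real F (fine (mu (cylinder i t))) /\
          of_real F (fine (mu (cylinder i t))) = 2 ^- n &
        forall E : set coin_space, measurable E ->
          finite_elt (P E) /\ shadow (P E) = fine (mu E)].
Proof.
have [U [Upt Ufit]] := fits_ultrafilter mu_kolmogorovian.
pose F := ultrapower_superreal R U.
pose nu (E : set coin_seq) : F := germ U (fun Y => (hits Y E)%:R).
have nuP : elementary_numerosity nu.
  split=> [A|x|A B AB0].
  - rewrite -germ0; apply/germ_le; apply: filterE => Y; exact: ler0n.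
  - rewrite -germ1; apply/germ_near; apply: filterS (Upt x) => Y xY.
    by rewrite /= hits1.
  - rewrite -germD; apply/germ_near; apply: filterE => Y.
    by rewrite /= hitsU// natrD.
have PE E : numerosity_prob nu E = germ U (fun Y => (hits Y E)%:R / #|` Y|%:R).
  rewrite /numerosity_prob -germV -germM; apply: germ_near; apply: filterE => Y.
  by rewrite /= hitsT.
pose w0 : coin_seq := fun=> true.
exists F, nu; split => //; split.
- by move=> E; exact: numerosity_prob_ge0_le1 w0 E.
- by move=> B fB B0 E; exact: numerosity_cond_prob.
- move=> n i t ii; split; last by rewrite mu_kolmogorovian// fmorphV rmorphXn rmorph_nat.
  have [N Ni] := cylinder_prefix_determined i t.
  rewrite PE; apply: germ_near.
  by apply: filterS (Ufit N [::] 0%N _) => // Y [/(_ _ Ni)].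
- move=> E mE; split.
    exists 2 => //; have /andP[P0 P1] := numerosity_prob_ge0_le1 nuP w0 E.
    by rewrite (lt_le_trans _ P0) ?oppr_lt0 ?ltr0n//= (le_lt_trans P1)// ltr1n.
  apply: shadow_unique => k k0.
  (* The next index turns the weak inequality into the strict one required. *)
  have : `|numerosity_prob nu E - of_real F (fine (mu E))| <= k.+1%:R^-1.
    rewrite -(rmorph_nat (of_real F)) -fmorphV ler_norml PE -rmorphN.
    have UE : U (fits mu 0%N [:: E] k) by apply: Ufit => A; rewrite mem_seq1 => /eqP ->.
    by rewrite -rmorphN /= /constant_germ -germD; apply/andP; split; apply/germ_le;
      apply: filterS UE => Y [_ /(_ E (mem_head _ _))]; rewrite ler_norml => /andP[].
  move=> /le_lt_trans; rewrite -ltr_norml; apply.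
  by rewrite ltf_pV2 ?posrE ?ltr0n// ltr_nat.
Qed.
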